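(* Let $\phi=\tilde p/p$ be a rational inner function with $\deg p=\deg\phi=(1,n)$, where $n\ge2$. Assume that $N_{\mathbb{T}^2}(p,\tilde p)=2n$, that $p$ is irreducible, and that all zeros of $p$ on $\mathbb{T}^2$ occur at $(1,1)$. Then $\phi$ is not in the Dirichlet space $\mathfrak D=\mathfrak D_1$ of the bidisk.
   Context: $p\in\mathbb{C}[z_1,z_2]$ has no zeros in $\mathbb{D}^2$, is atoral, and $\tilde p(z)=z_1^mz_2^n\overline{p(1/\bar z_1,1/\bar z_2)}$ for $\deg p=(m,n)$. $N_{\mathbb{T}^2}(p,\tilde p)$ denotes the sum over common zeros $\lambda\in\mathbb{T}^2$ of $p$ and $\tilde p$ of the intersection multiplicities $N_\lambda(p,\tilde p)$ (by Bézout this is at most $2mn$). $\mathfrak D$ is the space of holomorphic $f=\sum a_{k\ell}z_1^kz_2^\ell$ on $\mathbb{D}^2$ with $\sum_{k,\ell\ge0}(k+1)(\ell+1)|a_{k\ell}|^2<\infty$. *)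

(* Defs.v *)
(* C := R[i] for an arbitrary R : realType (a model of the
   real numbers), built with mathcomp-real-closed's [complex].
   Bivariate polynomials in C[z1,z2] are {poly {poly C}}: the OUTER variable
   is z2, the INNER (coefficient) variable is z1. *)
From HB Require Import structures.
From mathcomp Require Import all_boot all_order all_algebra.
From mathcomp Require Import reals complex.
Set Implicit Arguments. Unset Strict Implicit. Unset Printing Implicit Defensive.
Import Order.TTheory GRing.Theory Num.Theory.
Local Open Scope ring_scope.

Section Bivariate.
Variable R : realType.
Local Notation C := R[i].
Local Notation P := {poly {poly C}}.

Definition bcoef (p : P) (k l : nat) : C := (p`_l)`_k.

Definition beval (p : P) (a b : C) : C := (p.[b%:P]).[a].

Definition zcoef (p : P) (l : nat) : {poly C} := p`_l.
Definition deg1 (p : P) : nat := (\max_(l < size p) (size (zcoef p l)).-1)%N.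
Definition deg2 (p : P) : nat := (size p).-1.

Definition bconst (c : C) : P := (c%:P)%:P.

(* reflection  p~(z) = z1^m z2^n conj(p(1/conj z1, 1/conj z2)),
   i.e. coefficient (k,l) of p~ is conj (coefficient (m-k, n-l) of p) *)
Definition refl (m n : nat) (p : P) : P :=
  \poly_(l < n.+1) \poly_(k < m.+1) (bcoef p (m - k) (n - l))^*.

Definition in_disk (a : C) : Prop := `|a| < 1.
Definition in_circle (a : C) : Prop := `|a| = 1.

Definition no_zeros_bidisk (p : P) : Prop :=
  forall a b, in_disk a -> in_disk b -> beval p a b != 0.

Definition is_const (p : P) : Prop := exists c : C, p = bconst c.

Definition bdvd (f g : P) : Prop := exists h : P, g = f * h.

Definition no_common_factor (p q : P) : Prop :=
  forall f : P, bdvd f p -> bdvd f q -> is_const f.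

Definition birreducible (p : P) : Prop :=
  ~ is_const p /\ forall f g : P, p = f * g -> is_const f \/ is_const g.

(* f lies in the ideal generated by p and q in the local ring O_lam of
   C[z1,z2] at lam = (a,b) (rational functions regular at lam) *)
Definition in_local_ideal (p q : P) (lam : C * C) (f : P) : Prop :=
  exists g A B : P, beval g lam.1 lam.2 != 0 /\ g * f = A * p + B * q.

Definition indep_mod (p q : P) (lam : C * C) (k : nat) (f : 'I_k -> P) : Prop :=
  forall c : 'I_k -> C,
    in_local_ideal p q lam (\sum_(i < k) bconst (c i) * f i) ->
    forall i, c i = 0.

(* N_lam(p,q) = k : k = dim_C O_lam / (p,q) O_lam  (the local intersection
   multiplicity); images of polynomials span this quotient when finite *)
Definition intmult (p q : P) (lam : C * C) (k : nat) : Prop :=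
  (exists f : 'I_k -> P, indep_mod p q lam f) /\
  ~ (exists f : 'I_k.+1 -> P, indep_mod p q lam f).

Definition common_zero_T2 (p q : P) (lam : C * C) : Prop :=
  in_circle lam.1 /\ in_circle lam.2 /\
  beval p lam.1 lam.2 = 0 /\ beval q lam.1 lam.2 = 0.

Definition NT2 (p q : P) (N : nat) : Prop :=
  exists (s : seq (C * C)) (mu : C * C -> nat),
    uniq s /\ (forall lam, common_zero_T2 p q lam <-> lam \in s) /\
    (forall lam, lam \in s -> intmult p q lam (mu lam)) /\
    (\sum_(lam <- s) mu lam)%N = N.

Definition atoral (p : P) : Prop :=
  no_common_factor p (refl (deg1 p) (deg2 p) p).

(* a : nat -> nat -> C is the family of Taylor coefficients at 0 of q/p
   (Cauchy-product identity p * a = q; unique when p(0,0) <> 0) *)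
Definition taylor_coefs (q p : P) (a : nat -> nat -> C) : Prop :=
  forall k l, \sum_(i < k.+1) \sum_(j < l.+1)
      bcoef p i j * a (k - i)%N (l - j)%N = bcoef q k l.

Definition in_dirichlet (a : nat -> nat -> C) : Prop :=
  exists M : R, forall N : nat,
    \sum_(k < N) \sum_(l < N) (k.+1 * l.+1)%:R * `|a k l| ^+ 2 <= (M%:C)%C.

End Bivariate.

(* Main.v *)
(* Write p = p0(z2) + z1 p1(z2), psi = - p1 / p0, and let
   r = p0 p0~ - p1 p1~ be the resultant of p and p~ in z1. The z1-Taylor
   coefficients of p~/p are psi^k h (k >= 0) up to a shift, where h = r / p0^2.
   The singularity at (1,1) gives psi(1) = 1 and r = (z - 1)^N u(z) with N >= 1
   and u(1) <> 0, and psi'(1) <> 0 because psi maps the disk to itself.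
   On the circle |p0|^2 - |p1|^2 = |r|, so for a boundary point at distance e
   from 1 the point w at depth d = e^N / 2 below it satisfies
   1 - |psi(w)| = O(d) and |h(w)| >= c d. Hence for k between K and 2 K, with
   K d a large constant, |(psi^k h)'(w)| is bounded below, while Cauchy-Schwarz
   bounds |f'(w)|^2 d^2 by the one-variable Dirichlet norm of f. Each such block
   of indices therefore contributes at least a fixed constant to the Dirichlet
   norm of p~/p, and there are infinitely many disjoint blocks. *)
Require Import Defs.
From HB Require Import structures.
From mathcomp Require Import all_boot all_order all_algebra.
From mathcomp Require Import reals complex.
From mathcomp Require Import sequences exp trigo.
From mathcomp Require Import ring lra.
Import Order.TTheory GRing.Theory Num.Theory.
Local Open Scope ring_scope.

(** * Complex modulus and polynomial estimates *)

Section ComplexModulus.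
Set Implicit Arguments.
Unset Strict Implicit.

Variable R : realType.
Local Notation C := R[i].

Definition cabs (x : C) : R := ComplexField.Normc.normc x.

Lemma cabsE (x : C) : `|x| = (cabs x)%:C%C.
Proof. by []. Qed.

Lemma cabs_ge0 x : 0 <= cabs x.
Proof. by rewrite -ler0c -cabsE. Qed.

Lemma cabsM x y : cabs (x * y) = cabs x * cabs y.
Proof. exact: ComplexField.Normc.normcM. Qed.

Lemma cabsV x : cabs x^-1 = (cabs x)^-1.
Proof. exact: ComplexField.Normc.normcV. Qed.

Lemma cabs_div x y : cabs (x / y) = cabs x / cabs y.
Proof. by rewrite cabsM cabsV. Qed.

Lemma cabsN x : cabs (- x) = cabs x.
Proof. by apply: complexI; rewrite -!cabsE normrN. Qed.

Lemma cabsB x y : cabs (x - y) = cabs (y - x).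
Proof. by rewrite -cabsN opprB. Qed.

Lemma cabs0 : cabs 0 = 0.
Proof. exact: ComplexField.Normc.normc0. Qed.

Lemma cabs1 : cabs 1 = 1.
Proof. exact: ComplexField.Normc.normc1. Qed.

Lemma cabsX x n : cabs (x ^+ n) = cabs x ^+ n.
Proof. by elim: n => [|n IH]; rewrite ?cabs1 // !exprS cabsM IH. Qed.

Lemma cabs_conj x : cabs (x^*) = cabs x.
Proof. by apply: complexI; rewrite -!cabsE norm_conjC. Qed.

Lemma cabs_real (x : R) : cabs (x%:C)%C = `|x|.
Proof. by rewrite /cabs /= expr0n /= addr0 sqrtr_sqr. Qed.

Lemma cabs_nat n : cabs n%:R = n%:R.
Proof. by apply: complexI; rewrite -cabsE normr_nat rmorph_nat. Qed.

Lemma cabs_eq0 x : (cabs x == 0) = (x == 0).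
Proof. by rewrite -(inj_eq (@complexI R)) -cabsE normr_eq0. Qed.

Lemma cabs_gt0 x : (0 < cabs x) = (x != 0).
Proof. by rewrite lt_def cabs_ge0 andbT cabs_eq0. Qed.

Lemma cabsD x y : cabs (x + y) <= cabs x + cabs y.
Proof. by rewrite -lecR rmorphD -!cabsE ler_normD. Qed.

Lemma cabsB_le x y : cabs (x - y) <= cabs x + cabs y.
Proof. by rewrite (le_trans (cabsD _ _)) // cabsN. Qed.

Lemma cabsB_ge x y : cabs x - cabs y <= cabs (x - y).
Proof. by have := cabsD (x - y) y; rewrite subrK; lra. Qed.

Lemma cabs_sum (I : Type) (r : seq I) (P : pred I) (F : I -> C) :
  cabs (\sum_(i <- r | P i) F i) <= \sum_(i <- r | P i) cabs (F i).
Proof.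
apply: (big_ind2 (fun x y => cabs x <= y)) => //; first by rewrite cabs0.
by move=> x1 x2 y1 y2 h1 h2; apply: le_trans (cabsD _ _) (lerD h1 h2).
Qed.

Lemma cabs_sqr x : ((cabs x ^+ 2)%:C)%C = x * x^*.
Proof. by rewrite rmorphXn /= -cabsE normCK. Qed.

Lemma cabs2E x : cabs x ^+ 2 = complex.Re x ^+ 2 + complex.Im x ^+ 2.
Proof. by apply: complexI; rewrite add_Re2_Im2 rmorphXn /= -cabsE. Qed.

Lemma ler_Re_cabs x : `|complex.Re x| <= cabs x.
Proof. by rewrite -lecR -cabsE; exact: normc_ge_Re. Qed.

Lemma in_diskE (x : C) : in_disk x <-> cabs x < 1.
Proof. by rewrite /in_disk cabsE -(rmorph1 (real_complex R)) ltcR. Qed.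

Lemma poly_lipschitz (P : {poly C}) : exists2 K : R, 0 < K &
  forall x y, cabs x <= 2 -> cabs y <= 2 ->
    cabs (P.[x] - P.[y]) <= K * cabs (x - y).
Proof.
(* The difference of two products also needs a sup bound, so the induction carries [B] along with
   [K]. *)
suff [K [B [K0 B0 h]]] : exists K B : R, [/\ 0 < K, 0 < B &
  forall x y, cabs x <= 2 -> cabs y <= 2 -> cabs P.[x] <= B /\
    cabs (P.[x] - P.[y]) <= K * cabs (x - y)].
  by exists K => // x y hx hy; case: (h x y hx hy).
elim/poly_ind: P => [|P c [K [B [K0 B0 h]]]].
  exists 1, 1; split => // x y _ _; rewrite !horner0 subrr cabs0 mul1r.
  by split; rewrite ?ler01 ?cabs_ge0.
exists (2 * K + B), (2 * B + cabs c); have c0 := cabs_ge0 c.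
split; [lra|lra|move=> x y hx hy].
have [h1 h2] := h x y hx hy; have [h3 _] := h y x hy hx.
rewrite !hornerE; split.
  apply: (le_trans (cabsD _ _)); rewrite lerD2r cabsM.
  by rewrite mulrC; apply: ler_pM => //; apply: cabs_ge0.
have -> : P.[x] * x + c - (P.[y] * y + c) =
          (P.[x] - P.[y]) * x + P.[y] * (x - y) by ring.
apply: (le_trans (cabsD _ _)); rewrite !cabsM mulrDl; apply: lerD.
  by rewrite mulrC -mulrA; apply: ler_pM => //; apply: cabs_ge0.
by apply: ler_wpM2r => //; apply: cabs_ge0.
Qed.

Lemma poly_bounded (P : {poly C}) : exists2 K : R, 0 < K &
  forall x, cabs x <= 2 -> cabs P.[x] <= K.
Proof.
have [K K0 h] := poly_lipschitz P; exists (2 * K + cabs P.[0] ).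
  by have := cabs_ge0 P.[0]; lra.
move=> x hx; have := h x 0 hx; rewrite cabs0 subr0 => /(_ (ler0n _ _)) h1.
have := cabsB_ge P.[x] P.[0]; have := cabs_ge0 x; nra.
Qed.

Lemma poly_nonzero_near (P : {poly C}) (a : C) : cabs a <= 1 -> P.[a] != 0 ->
  exists c : R, exists2 e : R, 0 < c /\ 0 < e <= 1 &
    forall x, cabs (x - a) <= e -> c <= cabs P.[x].
Proof.
move=> ha; rewrite -cabs_gt0 => Pa; have [K K0 h] := poly_lipschitz P.
set p := cabs P.[a] in Pa *.
(* This radius makes the Lipschitz error at most [p / 2]; the cap 1 keeps [x] in the disk of radius
   2, where [h] applies. *)
exists (p / 2), (Num.min 1 (p / (2 * K))).
  split; first by lra.
  by rewrite lt_min ltr01 /= divr_gt0 ?mulr_gt0 // ge_min lexx.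
move=> x; rewrite le_min => /andP[h1 h2].
have hx : cabs x <= 2 by have := cabsD (x - a) a; rewrite subrK; lra.
have := h x a hx; rewrite (le_trans ha) ?ler1n // => /(_ isT) h3.
have h4 : K * cabs (x - a) <= p / 2.
  by rewrite mulrC -ler_pdivlMr // -mulrA -invfM.
by have := cabsB_ge P.[a] P.[x]; rewrite cabsB -/p; lra.
Qed.

Lemma deMoivre (t : R) m :
  ((cos t +i* sin t) ^+ m = cos (m%:R * t) +i* sin (m%:R * t))%C.
Proof.
elim: m => [|m IH]; first by rewrite mul0r cos0 sin0.
rewrite exprS IH -natr1 mulrDl mul1r cosD sinD.
by apply/eqP; rewrite eq_complex /=; apply/andP; split; apply/eqP; ring.
Qed.

End ComplexModulus.

(** * Simple zeros on the boundary *)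

Section SimpleRoot.
Set Implicit Arguments.
Unset Strict Implicit.

Variable R : realType.
Local Notation C := R[i].
Implicit Types (u z : C) (f v : {poly C}).

Lemma Re_realM (x : R) z : complex.Re ((x%:C)%C * z) = x * complex.Re z.
Proof. by case: z => a b /=; rewrite mul0r subr0. Qed.

(** At [z = 1 + d u] the hypothesis has leading term [d^m Re (u^m v(1) conj f(1))] as [d] tends to
    0, and [Re u < 0] makes [z] enter the disk. A negative leading coefficient would show for small
    [d]. *)
Lemma boundary_direction f v m u :
  (forall z, cabs z < 1 ->
     0 <= complex.Re ((z - 1) ^+ m * v.[z] * (f.[z])^*)) ->
  complex.Re u < 0 -> 0 <= complex.Re (u ^+ m * (v.[1] * (f.[1])^*)).
Proof.
move=> H hu; rewrite leNgt; apply/negP; set x := complex.Re _ => hx.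
have [K1 K1p l1] := poly_lipschitz v; have [K2 K2p l2] := poly_lipschitz f.
have [B1 B1p b1] := poly_bounded v; have [B2 B2p b2] := poly_bounded f.
set U := cabs u; have U0 : 0 <= U := cabs_ge0 u.
set A := (K1 * B2 + B1 * K2) * U; set M := U ^+ m.
have M0 : 0 <= M by rewrite exprn_ge0.
have A0 : 0 <= A by rewrite /A mulr_ge0 // addr_ge0 // mulr_ge0 // ltW.
have c1 : cabs (1 : C) <= 2 by rewrite cabs1 ler1n.
(* [hd2] places [z] in the disk, and [hd3] keeps the error term below [- x / 2]. *)
have [d d0 [hd1 hd2 hd3]] : exists2 d : R, 0 < d & [/\ d * (1 + U) <= 1,
    d * (1 + U ^+ 2) <= - complex.Re u & d * (1 + M * A) <= - x / 2].
  have p1 : 0 < 1 + U by lra.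
  have p2 : 0 < 1 + U ^+ 2 by nra.
  have p3 : 0 < 1 + M * A by nra.
  exists (Num.min (1 / (1 + U)) (Num.min (- complex.Re u / (1 + U ^+ 2))
     (- x / 2 / (1 + M * A)))).
    by rewrite !lt_min !divr_gt0 //; lra.
  by split; rewrite -ler_pdivlMr // !ge_min lexx ?orbT.
set z := 1 + (d%:C)%C * u.
have zd : cabs (z - 1) = d * U.
  by rewrite /z addrC addKr cabsM cabs_real gtr0_norm.
have z1 : cabs z < 1.
  suff : cabs z ^+ 2 < 1 by have := cabs_ge0 z; nra.
  have : U ^+ 2 = complex.Re u ^+ 2 + complex.Im u ^+ 2 by exact: cabs2E.
  have -> : cabs z ^+ 2 =
    1 + d * (2 * complex.Re u + d * (complex.Re u ^+ 2 + complex.Im u ^+ 2)).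
    by rewrite cabs2E /z; case: (u) => a b /=; ring.
  by move=> <-; nra.
have z2 : cabs z <= 2 by lra.
have := H z z1; rewrite {1}/z addrC addKr exprMn -rmorphXn -!mulrA Re_realM.
rewrite pmulr_rge0 ?exprn_gt0 //; apply/negP; rewrite -ltNge.
set y := v.[z] * _; set y1 := v.[1] * (f.[1])^* in x hx hd3 *.
have hy : cabs (y - y1) <= A * d.
  have -> : y - y1 = (v.[z] - v.[1]) * (f.[z])^* + v.[1] * (f.[z] - f.[1])^*.
    by rewrite rmorphB /y /y1; ring.
  apply: (le_trans (cabsD _ _)); rewrite !cabsM !cabs_conj.
  have -> : A * d = (K1 * (d * U)) * B2 + B1 * (K2 * (d * U)) by rewrite /A; ring.
  have e1 := l1 _ _ z2 c1; have e2 := l2 _ _ z2 c1.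
  rewrite zd in e1 e2.
  by apply: lerD; apply: ler_pM; rewrite ?cabs_ge0 ?b1 ?b2.
have -> : u ^+ m * y = u ^+ m * y1 + u ^+ m * (y - y1) by ring.
have -> : complex.Re (u ^+ m * y1 + u ^+ m * (y - y1)) =
   x + complex.Re (u ^+ m * (y - y1)).
  by rewrite /x; case: (_ * y1) => ? ?; case: (_ * _).
have := le_trans (ler_norm _) (ler_Re_cabs (u ^+ m * (y - y1))).
rewrite cabsM cabsX -/M; have : M * cabs (y - y1) <= M * (A * d) by exact: ler_wpM2l.
by nra.
Qed.

(** The directions are [- exp (i t)] and [- exp (- i t)] with [t = 3 pi / (4 m)]. Since [m >= 2],
    [t < pi / 2] and both point into the left half-plane; [v] has argument [3 pi / 4]. *)
Lemma exists_root_direction m : (2 <= m)%N -> exists u1 u2 v : C,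
  [/\ complex.Re u1 < 0, complex.Re u2 < 0, u1 ^+ m = (-1) ^+ m * v,
      u2 ^+ m = (-1) ^+ m * v^* & complex.Re v < 0 /\ 0 < complex.Im v].
Proof.
move=> m2; set t : R := 3 / 4 * pi / m%:R.
have m0 : (0 : R) < m%:R by rewrite ltr0n (leq_trans _ m2).
have pi0 : 0 < pi :> R := pi_gt0 R.
have tb : 0 < t < pi / 2.
  rewrite /t divr_gt0 ?mulr_gt0 //; last by lra.
  rewrite ltr_pdivrMr //; have : (2 : R) <= m%:R by rewrite ler_nat.
  by nra.
have ct : 0 < cos t by apply: cos_gt0_pihalf; lra.
have mt : m%:R * t = pi / 4 + pi / 2.
  by rewrite /t; field; rewrite lt0r_neq0.
exists (- (cos t +i* sin t))%C, (- (cos t -i* sin t))%C,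
  (cos (m%:R * t) +i* sin (m%:R * t))%C.
have cj : ((cos t -i* sin t) = (cos t +i* sin t)^*)%C by [].
split; [by rewrite /= oppr_lt0|by rewrite /= oppr_lt0| | |].
- by rewrite [LHS]exprNn deMoivre.
- rewrite [LHS]exprNn cj; congr (_ * _).
  by rewrite -[RHS]/(conjc (_ +i* _)%C) -deMoivre rmorphXn.
- rewrite mt /= cosDpihalf sinDpihalf oppr_lt0.
  have c4 : 0 < cos (pi / 4) :> R by apply: cos_gt0_pihalf; lra.
  split=> //; have : pi / 4 = pi / 2 - pi / 4 :> R by lra.
  move=> ->; have -> : pi / 2 - pi / 4 = - (pi / 4) + pi / 2 :> R by lra.
  by rewrite sinDpihalf cosN.
Qed.

(** Adding the last two inequalities gives [Re v * Re b >= 0], hence [Re b = 0]; separately they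
    then force [Im b = 0]. *)
Lemma three_directions (b v : C) : complex.Re v < 0 -> 0 < complex.Im v ->
  0 <= complex.Re b -> 0 <= complex.Re (v * b) -> 0 <= complex.Re (v^* * b) ->
  b = 0.
Proof.
have -> : (v^* = complex.conjc v)%R by [].
case: b v => b1 b2 [v1 v2] /= h1 h2 h3 h4 h5.
have b10 : b1 = 0 by apply/eqP; rewrite eq_le h3 andbT; nra.
have b20 : b2 = 0 by apply/eqP; rewrite eq_le; apply/andP; split; nra.
by rewrite b10 b20.
Qed.

(* If the root had order m >= 2, then (f - g) / f would wind around 1 through an
   angle m * pi >= 2 * pi on the half-disk, and could not stay in the disk. *)
Lemma boundary_root_simple (f g : {poly C}) :
  (forall z, cabs z < 1 -> cabs (g - f).[z] <= cabs f.[z]) ->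
  g != 0 -> g.[1] = 0 -> f.[1] != 0 -> (g^`()).[1] != 0.
Proof.
move=> H g0 g1 f1; have [m [v v1 gE]] := multiplicity_XsubC g 1.
rewrite g0 /= in v1.
(* Squaring [|g - f| <= |f|] gives [2 Re (g conj f) >= |g|^2 >= 0]. *)
have Re0 z : cabs z < 1 -> 0 <= complex.Re ((z - 1) ^+ m * v.[z] * (f.[z])^*).
  move=> /H; have -> : (z - 1) ^+ m * v.[z] = g.[z].
    by rewrite gE !hornerE mulrC.
  rewrite !hornerE => h.
  have : cabs (g.[z] - f.[z]) ^+ 2 <= cabs f.[z] ^+ 2.
    by rewrite ler_pXn2r // ?nnegrE cabs_ge0.
  rewrite !cabs2E; have -> : ((f.[z])^* = complex.conjc f.[z])%R by [].
  by case: (g.[z]) (f.[z]) => a b [c d] /=; nra.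
case: m gE Re0 => [|[|m]] gE Re0.
- by move: g1 v1; rewrite gE !hornerE /root => ->; rewrite eqxx.
- rewrite gE expr1 derivM derivB derivX derivC !hornerE subrr.
  by rewrite mulr0 add0r subr0 mulr1.
(* For order at least 2, the directions [-1], [u1], [u2] confine [v(1) conj f(1)], up to sign, to
   three half-planes that meet only in 0. *)
have [//|u1 [u2 [w [r1 r2 e1 e2 [w1 w2]]]]] := @exists_root_direction m.+2.
have rm : complex.Re (-1 : C) < 0 by rewrite /= ltrN10.
have h1 := boundary_direction Re0 rm.
have h2 := boundary_direction Re0 r1.
have h3 := boundary_direction Re0 r2.
move: h1 h2 h3; rewrite e1 e2 ![_ * w * _]mulrAC ![_ * w^* * _]mulrAC.
rewrite ![_ * w]mulrC ![_ * w^*]mulrC => h1 h2 h3.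
have := three_directions w1 w2 h1 h2 h3.
move/eqP; rewrite mulf_eq0 signr_eq0 mulf_eq0 conjC_eq0 (negPf f1) orbF /= => v0.
by move: v1; rewrite /root v0.
Qed.
End SimpleRoot.

(** * Truncated power series *)

Section TruncatedSeries.
Set Implicit Arguments.
Unset Strict Implicit.

Variable R : realType.
Local Notation C := R[i].
Implicit Types (f g : {poly C}) (s : nat -> C) (w : C).

Definition null_seq (u : nat -> C) : Prop :=
  forall e : R, 0 < e -> exists N, forall L, (N <= L)%N -> cabs (u L) <= e.

Lemma null_le (u : nat -> C) (v : nat -> R) :
  (forall L, cabs (u L) <= v L) ->
  (forall e : R, 0 < e -> exists N, forall L, (N <= L)%N -> v L <= e) -> null_seq u.
Proof.
move=> uv v0 e /v0[N hN]; exists N => L /hN; exact: le_trans (uv L).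
Qed.

Lemma null_ext u v : u =1 v -> null_seq u -> null_seq v.
Proof. by move=> uv u0 e /u0[N hN]; exists N => L /hN; rewrite uv. Qed.

Lemma nullD u v : null_seq u -> null_seq v -> null_seq (fun L => u L + v L).
Proof.
move=> u0 v0 e e0; have e20 : 0 < e / 2 by lra.
have [N hN] := u0 _ e20; have [M hM] := v0 _ e20.
exists (maxn N M) => L; rewrite geq_max => /andP[/hN h1 /hM h2].
by apply: le_trans (cabsD _ _) _; lra.
Qed.

Lemma nullZ c u : null_seq u -> null_seq (fun L => c * u L).
Proof.
move=> u0 e e0; have c0 := cabs_ge0 c.
have [|N hN] := u0 (e / (1 + cabs c)); first by rewrite divr_gt0 //; lra.
exists N => L /hN; rewrite cabsM ler_pdivlMr; last by lra.
by have := cabs_ge0 (u L); nra.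
Qed.

Lemma sqr_geometric_small (x : R) d : 0 <= x < 1 -> forall e : R, 0 < e ->
  exists N, forall L, (N <= L)%N -> (L + d)%:R ^+ 2 * x ^+ L <= e.
Proof.
move=> /andP[x0 x1] e e0; set y := 1 - x; have y0 : 0 < y by rewrite /y; lra.
(* Here [24 = 4 * 6]: [(L + d)^2 <= 4 L^2] once [d <= L], and [x^L <= exp (- L y) <= 6 / (L y)^3] by
   the cubic Taylor term. The product is [c / L]. *)
set c := 24 / y ^+ 3; have c0 : 0 < c by rewrite divr_gt0 ?exprn_gt0.
exists (maxn d.+1 (Num.bound (c / e))) => L; rewrite geq_max => /andP[dL].
move=> hL; have Lce : c / e <= L%:R.
  have := archi_boundP (ltW (divr_gt0 c0 e0)).
  by move=> /ltW /le_trans; apply; rewrite ler_nat.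
have L0 : (0 : R) < L%:R by rewrite ltr0n (leq_trans _ dL).
have xL : x ^+ L <= 6 / (y * L%:R) ^+ 3.
  have : x ^+ L <= expR (- (L%:R * y)).
    rewrite -mulrN expRM_natl; apply: lerXn2r; rewrite ?nnegrE ?expR_ge0 //.
    by have := expR_ge1Dx (- y); rewrite /y; lra.
  move=> /le_trans; apply; rewrite expRN -[6 / _]invrK invf_div.
  rewrite lef_pV2 ?posrE ?expR_gt0 ?divr_gt0 ?exprn_gt0 ?mulr_gt0 //.
  have Ly0 : 0 <= L%:R * y by rewrite mulr_ge0 // ltW.
  have := @expR_ge1Dxn R _ 2 Ly0; rewrite [y * _]mulrC.
  have -> : (3`!%:R = 6 :> R) by []. 
  by lra.
have L2 : (L + d)%:R ^+ 2 <= 4 * (L%:R : R) ^+ 2.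
  have : d%:R <= L%:R :> R by rewrite ler_nat ltnW.
  by rewrite natrD; have : (0 : R) <= d%:R := ler0n _ _; nra.
apply: (@le_trans _ _ (4 * L%:R ^+ 2 * (6 / (y * L%:R) ^+ 3))).
  by apply: ler_pM => //; rewrite exprn_ge0.
have -> : 4 * L%:R ^+ 2 * (6 / (y * L%:R) ^+ 3) = c / L%:R.
  by rewrite /c; field; rewrite !lt0r_neq0.
by rewrite ler_pdivrMr // mulrC -ler_pdivrMr.
Qed.

(** Only coefficients of index at least [L] survive, so every term carries about [|w|^L], which
    beats the quadratic growth coming from the number of terms and from differentiation. *)
Lemma high_order_null (T : nat -> {poly C}) d (B : R) w : cabs w < 1 ->
  (forall L l, (l < L)%N -> (T L)`_l = 0) ->
  (forall L, (size (T L) <= L + d)%N) ->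
  (forall L l, cabs (T L)`_l <= B) ->
  null_seq (fun L => (T L).[w]) /\ null_seq (fun L => ((T L)^`()).[w]).
Proof.
move=> w1 low sz bd; have B0 : 0 <= B := le_trans (cabs_ge0 _) (bd 0 0).
set x := cabs w in w1; have x0 : 0 <= x := cabs_ge0 w.
have x01 : 0 <= x < 1 by rewrite x0.
have powle i L : (L <= i)%N -> x ^+ i <= x ^+ L.
  by move=> h; apply: ler_wiXn2l => //; exact: ltW.
have small k : forall e : R, 0 < e -> exists N, forall L, (N <= L)%N ->
    B * ((L + d)%:R ^+ 2 * x ^+ (L - k)) <= e.
  move=> e e0; have e1 : 0 < e / (1 + B) by rewrite divr_gt0 //; lra.
  have [N hN] := @sqr_geometric_small x (d + k) x01 _ e1.
  exists (N + k)%N => L hL.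
  have kL : (k <= L)%N by rewrite (leq_trans _ hL) // leq_addl.
  have := hN (L - k)%N; rewrite leq_subRL // addnC hL addnCA subnK //.
  move=> /(_ isT); rewrite ler_pdivlMr; last by lra.
  rewrite [(d + L)%N]addnC; set z := _ * x ^+ _.
  have : 0 <= z by rewrite mulr_ge0 // exprn_ge0.
  by nra.
have scale_sum (k L : nat) : \sum_(i < L + d) B * ((L + d)%:R * x ^+ (L - k)) =
    B * ((L + d)%:R ^+ 2 * x ^+ (L - k)).
  by rewrite sumr_const card_ord -mulr_natl; ring.
split.
  apply: null_le (small 0%N) => L; rewrite -scale_sum subn0.
  rewrite (horner_coef_wide _ (sz L)); apply: le_trans (cabs_sum _ _ _) _.
  apply: ler_sum => i _; rewrite cabsM cabsX -/x.
  have [iL|Li] := ltnP i L.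
    by rewrite low // cabs0 mul0r !mulr_ge0 // exprn_ge0.
  apply: ler_pM; rewrite ?cabs_ge0 ?exprn_ge0 //.
  have : (1 : R) <= (L + d)%:R by rewrite ler1n (leq_ltn_trans _ (ltn_ord i)).
  have xL : 0 <= x ^+ L by rewrite exprn_ge0.
  by have := powle _ _ Li; nra.
apply: null_le (small 1%N) => L; rewrite -scale_sum.
rewrite (@horner_coef_wide _ (L + d)); last first.
  exact: leq_trans (leq_trans (size_poly _ _) (leq_pred _)) (sz L).
apply: le_trans (cabs_sum _ _ _) _; apply: ler_sum => i _.
rewrite coef_deriv -[_`__ *+ _]mulr_natl !cabsM cabsX cabs_nat -/x.
have [iL|Li] := ltnP i.+1 L.
  by rewrite low // cabs0 mulr0 mul0r !mulr_ge0 // exprn_ge0.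
rewrite [_ * cabs _]mulrC -mulrA; apply: ler_pM; rewrite ?cabs_ge0 ?mulr_ge0 ?exprn_ge0 //.
apply: ler_pM; rewrite ?exprn_ge0 ?ler_nat //.
by apply: powle; rewrite leq_subLR add1n.
Qed.

(** The power series itself is never summed: its value and derivative in the disk are reached only
    as limits of these polynomials, through [null_seq]. *)
Definition trunc s L : {poly C} := \poly_(l < L) s l.

Lemma coefM_bounded f : exists2 K : R, 0 <= K & forall (A : {poly C}) (B : R),
  (forall l, cabs A`_l <= B) -> forall l, cabs (f * A)`_l <= K * B.
Proof.
elim/poly_ind: f => [|f c [K K0 h]].
  by exists 0 => // A B _ l; rewrite mul0r coef0 cabs0 mul0r.
exists (K + cabs c); first by rewrite addr_ge0 ?cabs_ge0.
move=> A B hA l; have B0 : 0 <= B := le_trans (cabs_ge0 _) (hA 0).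
rewrite mulrDl mulrAC coefD coefMX coefCM mulrDl.
apply: le_trans (cabsD _ _) _; apply: lerD.
  by case: eqP => _; rewrite ?cabs0 ?mulr_ge0 // h.
by rewrite cabsM ler_wpM2l ?cabs_ge0.
Qed.

(* The Taylor identity f1 s1 + f2 s2 = g survives truncation up to a
   remainder divisible by X^L, which vanishes in the limit inside the disk. *)
Lemma trunc_convolution_null f1 f2 g s1 s2 (B : R) w : cabs w < 1 ->
  (forall l, cabs (s1 l) <= B) -> (forall l, cabs (s2 l) <= B) ->
  (forall l, \sum_(j < l.+1) f1`_j * s1 (l - j)%N +
             \sum_(j < l.+1) f2`_j * s2 (l - j)%N = g`_l) ->
  let T L : {poly C} := f1 * trunc s1 L + f2 * trunc s2 L - g in
  null_seq (fun L => (T L).[w]) /\ null_seq (fun L => ((T L)^`()).[w]).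
Proof.
move=> w1 b1 b2 E T.
have B0 : 0 <= B := le_trans (cabs_ge0 _) (b1 0).
have [K1 K10 h1] := coefM_bounded f1; have [K2 K20 h2] := coefM_bounded f2.
have [K3 K30 h3] := coefM_bounded g.
have tb s : (forall l, cabs (s l) <= B) -> forall L l, cabs (trunc s L)`_l <= B.
  by move=> hs L l; rewrite coef_poly; case: ifP; rewrite ?cabs0.
apply: (@high_order_null T (size f1 + size f2 + size g) (K1 * B + K2 * B + K3)).
- exact: w1.
- move=> L l lL; rewrite /T !coefD coefN -E !coefM.
  apply/eqP; rewrite subr_eq0; apply/eqP; congr (_ + _); apply: eq_bigr => j _;
    by rewrite coef_poly (leq_ltn_trans (leq_subr _ _) lL).
- move=> L; have sz f s : (size (f * trunc s L)%R <= L + size f)%N.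
    apply: leq_trans (size_polyMleq _ _) _; apply: leq_trans (leq_pred _) _.
    by rewrite addnC leq_add2r size_poly.
  apply: leq_trans (size_polyD _ _) _; rewrite geq_max size_polyN.
  apply/andP; split; last by rewrite addnA leq_addl.
  apply: leq_trans (size_polyD _ _) _; rewrite geq_max.
  apply/andP; split; apply: (leq_trans (sz _ _)); rewrite leq_add2l.
    by rewrite -addnA leq_addr.
  by rewrite addnAC leq_addl.
- move=> L l; rewrite /T !coefD coefN.
  apply: le_trans (cabsB_le _ _) _; apply: lerD; last first.
    have := h3 1 1; rewrite !mulr1; apply=> k; rewrite coef1.
    by case: (k == 0); rewrite ?cabs1 ?cabs0.
  apply: le_trans (cabsD _ _) _.
  by apply: lerD; [apply: h1|apply: h2]; apply: tb.
Qed.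

Lemma sum_deriv_geometric (y : R) M : (1 - y) ^+ 2 *
  (\sum_(l < M.+1) l%:R * y ^+ l.-1) = 1 - M.+1%:R * y ^+ M + M%:R * y ^+ M.+1.
Proof.
elim: M => [|M IH]; first by rewrite big_ord1 /=; ring.
rewrite big_ord_recr mulrDr IH /= !exprS -!natr1; ring.
Qed.

Lemma sum_deriv_geometric_le (y : R) L : 0 <= y <= 1 ->
  (1 - y) ^+ 2 * (\sum_(l < L) l%:R * y ^+ l.-1) <= 1.
Proof.
case: L => [|M] /andP[y0 y1]; first by rewrite big_ord0 mulr0 ler01.
rewrite sum_deriv_geometric exprS -natr1.
have : 0 <= y ^+ M by rewrite exprn_ge0.
have : (0 : R) <= M%:R := ler0n _ _.
set a := M%:R; set b := y ^+ M => a0 b0.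
have : 0 <= a * b by rewrite mulr_ge0.
by nra.
Qed.

(* Cauchy-Schwarz for the pairing of the Dirichlet space with the derivative
   of its reproducing kernel at w. *)
Lemma trunc_deriv_le s w L (d : R) : cabs w < 1 -> 0 < d <= 1 - cabs w ^+ 2 ->
  cabs ((trunc s L)^`()).[w] ^+ 2 * d ^+ 2 <=
    \sum_(l < L) l.+1%:R * cabs (s l) ^+ 2.
Proof.
move=> w1 /andP[d0 d1]; set x := cabs w in w1 d1 *; have x0 : 0 <= x := cabs_ge0 w.
set X := cabs _; set S := \sum_(l < L) _; set y := x ^+ 2.
have X0 : 0 <= X := cabs_ge0 _.
have y01 : 0 <= y <= 1 by rewrite exprn_ge0 // /y; nra.
have Q := @sum_deriv_geometric_le y L y01; set G := \sum_(l < L) _ in Q.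
have G0 : 0 <= G by apply: sumr_ge0 => l _; rewrite mulr_ge0 // !exprn_ge0.
have hX : X <= \sum_(l < L) l%:R * (cabs (s l) * x ^+ l.-1).
  rewrite /X /trunc poly_def linear_sum /= horner_sum.
  apply: le_trans (cabs_sum _ _ _) _; apply: ler_sum => l _.
  rewrite derivZ derivXn hornerZ hornerMn hornerXn -[_ ^+ _ *+ _]mulr_natl.
  by rewrite !cabsM cabs_nat cabsX mulrCA.
(* Cauchy-Schwarz termwise, as [2 c u v <= u^2 + c^2 v^2] weighted by [l]. The choice [c = X d^2]
   and [d^2 G <= 1] let half of the left side absorb the last term. *)
have : 2 * (X * d ^+ 2) * X <= S + (X * d ^+ 2) ^+ 2 * G.
  set c := X * d ^+ 2; have c0 : 0 <= c by rewrite mulr_ge0 ?exprn_ge0 // ltW.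
  apply: (@le_trans _ _ (2 * c * \sum_(l < L) l%:R * (cabs (s l) * x ^+ l.-1))).
    by rewrite ler_wpM2l // mulr_ge0.
  rewrite !mulr_sumr -big_split /=; apply: ler_sum => l _.
  rewrite /y -exprM mulnC exprM -[l.+1%:R]natr1.
  set u := cabs _; set v := x ^+ _; have : (0 : R) <= l%:R := ler0n _ _.
  set m := l%:R => m0; rewrite -subr_ge0.
  have -> : (m + 1) * u ^+ 2 + c ^+ 2 * (m * v ^+ 2) - 2 * c * (m * (u * v)) =
            u ^+ 2 + m * (u - c * v) ^+ 2 by ring.
  by apply: addr_ge0; [exact: sqr_ge0|apply: mulr_ge0; rewrite ?sqr_ge0].
have : (X * d ^+ 2) ^+ 2 * G <= X ^+ 2 * d ^+ 2.
  have -> : (X * d ^+ 2) ^+ 2 * G = X ^+ 2 * d ^+ 2 * (d ^+ 2 * G) by ring.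
  apply: ler_piMr; first by apply: mulr_ge0; apply: sqr_ge0.
  apply: le_trans Q.
  apply: ler_wpM2r => //; apply: lerXn2r; rewrite ?nnegrE /y; lra.
have -> : 2 * (X * d ^+ 2) * X = 2 * (X ^+ 2 * d ^+ 2) by ring.
by lra.
Qed.
End TruncatedSeries.

(** * Slices of a quotient of polynomials of degree one in z1 *)

Section SliceCoefficients.
Set Implicit Arguments.
Unset Strict Implicit.

Variable R : realType.
Local Notation C := R[i].
Implicit Types (s : nat -> C) (w : C).

(** The identity [f1 s1 + f2 s2 = g] and its derivative can be solved at [w] for the data of [s1] by
    dividing by [f1(w)], which transfers limits from [s2] to [s1]. *)
Lemma trunc_limit_step (f1 f2 g : {poly C}) s1 s2 (B : R) w (F1 F2 D1 D2 : C) :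
  cabs w < 1 -> f1.[w] != 0 ->
  (forall l, cabs (s1 l) <= B) -> (forall l, cabs (s2 l) <= B) ->
  (forall l, \sum_(j < l.+1) f1`_j * s1 (l - j)%N +
             \sum_(j < l.+1) f2`_j * s2 (l - j)%N = g`_l) ->
  f1.[w] * F1 + f2.[w] * F2 = g.[w] ->
  (f1^`()).[w] * F1 + f1.[w] * D1 + ((f2^`()).[w] * F2 + f2.[w] * D2) =
    (g^`()).[w] ->
  null_seq (fun L => (trunc s2 L).[w] - F2) ->
  null_seq (fun L => ((trunc s2 L)^`()).[w] - D2) ->
  null_seq (fun L => (trunc s1 L).[w] - F1) /\
  null_seq (fun L => ((trunc s1 L)^`()).[w] - D1).
Proof.
move=> w1 f1w b1 b2 E EF ED nF nD.
have [T0 T1] := trunc_convolution_null w1 b1 b2 E.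
have nF1 : null_seq (fun L => (trunc s1 L).[w] - F1).
  apply: null_ext (nullZ (f1.[w])^-1 (nullD T0 (nullZ (- f2.[w]) nF))) => L.
  rewrite !(hornerD, hornerN, hornerM) -EF; field; exact: f1w.
split=> //.
apply: null_ext (nullZ (f1.[w])^-1 (nullD (nullD T1 (nullZ (- f2.[w]) nD))
  (nullD (nullZ (- (f1^`()).[w]) nF1) (nullZ (- (f2^`()).[w]) nF)))) => L.
rewrite derivB derivD !derivM !(hornerD, hornerN, hornerM) -ED.
by field; exact: f1w.
Qed.

Variables p0 p1 q0 q1 : {poly C}.

(** [res_poly] is the resultant in [z1] of [p0 + z1 p1] and [q0 + z1 q1]; [wronsk / p0^2] is the
    derivative of [psi], and [dnum / p0^3] that of [res_poly / p0^2]. Since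
    [p0 + z1 p1 = p0 (1 - z1 psi)], the expansion in [z1] is geometric in [psi]. *)
Definition res_poly : {poly C} := p0 * q1 - p1 * q0.
Definition wronsk : {poly C} := p1 * p0^`() - p1^`() * p0.
Definition dnum : {poly C} := res_poly^`() * p0 - res_poly * p0^`() *+ 2.
Definition psi w : C := - p1.[w] / p0.[w].

(* Values at w of the z1-Taylor coefficients of (q0 + z1 q1) / (p0 + z1 p1). *)
Definition slice w k : C :=
  if k is j.+1 then psi w ^+ j * (res_poly.[w] / p0.[w] ^+ 2) else q0.[w] / p0.[w].

(** The derivative of [slice] in [w]. From [k = 2] on, [psi^(k - 2)] is factored out, leaving
    [psi h' + (k - 1) psi' h] with [h = res_poly / p0^2]; no division by [psi] occurs. *)
Definition dslice w k : C :=
  match k with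
  | 0 => ((q0^`()).[w] * p0.[w] - q0.[w] * (p0^`()).[w]) / p0.[w] ^+ 2
  | 1 => dnum.[w] / p0.[w] ^+ 3
  | j.+2 => psi w ^+ j * (psi w * (dnum.[w] / p0.[w] ^+ 3) +
      j.+1%:R * (wronsk.[w] / p0.[w] ^+ 2 * (res_poly.[w] / p0.[w] ^+ 2)))
  end.

(** Each row follows from the preceding one through division by [p0]. Values accompany derivatives
    in the induction because the differentiated recurrence contains both. *)
Lemma slice_limits (a : nat -> nat -> C) (B : R) w :
  (forall k l, cabs (a k l) <= B) -> cabs w < 1 -> p0.[w] != 0 ->
  (forall l, \sum_(j < l.+1) p0`_j * a 0 (l - j)%N = q0`_l) ->
  (forall l, \sum_(j < l.+1) p0`_j * a 1 (l - j)%N +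
             \sum_(j < l.+1) p1`_j * a 0 (l - j)%N = q1`_l) ->
  (forall k l, \sum_(j < l.+1) p0`_j * a k.+2 (l - j)%N +
             \sum_(j < l.+1) p1`_j * a k.+1 (l - j)%N = 0) ->
  forall k, null_seq (fun L => ((trunc (a k) L)^`()).[w] - dslice w k).
Proof.
move=> bd w1 pw E0 E1 E2 k.
suff [] : null_seq (fun L => (trunc (a k) L).[w] - slice w k) /\
  null_seq (fun L => ((trunc (a k) L)^`()).[w] - dslice w k) by [].
have B0 : 0 <= B := le_trans (cabs_ge0 _) (bd 0 0).
have n0 : null_seq (fun=> 0 : C).
  by move=> e e0; exists 0%N => L _; rewrite cabs0 ltW.
elim: k => [|[|k] [IF ID]].
- apply: (@trunc_limit_step p0 0 q0 _ (fun=> 0) B w _ 0 _ 0) => //.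
  + by move=> l; rewrite cabs0.
  + by move=> l; rewrite -E0 [X in _ + X]big1 ?addr0 // => j _; rewrite mulr0.
  + by rewrite horner0 mul0r addr0 /slice; field.
  + by rewrite deriv0 !horner0 !mul0r !addr0 /slice /dslice; field.
  + apply: null_ext n0 => L; rewrite /trunc poly_def big1 ?horner0 ?subr0 //.
    by move=> i _; rewrite scale0r.
  + apply: null_ext n0 => L; rewrite /trunc poly_def big1 ?deriv0 ?horner0 ?subr0 //.
    by move=> i _; rewrite scale0r.
- apply: (@trunc_limit_step p0 p1 q1 _ _ B w _ _ _ _ _ _ _ _ _ _ _ IF ID) => //.
  + by rewrite /slice /res_poly !(hornerD, hornerN, hornerM) expr0; field.
  + rewrite /slice /dslice /dnum /res_poly derivB !derivM !(hornerD, hornerN, hornerM, hornerMn).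
    by field.
- apply: (@trunc_limit_step p0 p1 0 _ _ B w _ _ _ _ _ _ _ _ _ _ _ IF ID) => //.
  + by move=> l; rewrite coef0 E2.
  + by rewrite /slice horner0 exprS /psi; field.
  + rewrite deriv0 horner0 /slice.
    case: k {IF ID} => [|k].
      by rewrite /dslice /wronsk /psi !(hornerD, hornerN, hornerM); field.
    rewrite /dslice /wronsk !exprS -[k.+2%:R]natr1 /psi !(hornerD, hornerN, hornerM).
    by field.
Qed.

(** The rational parametrization of the circle at [t = e / 2] has
    [|z - 1|^2 = 4 t^2 / (1 + t^2) <= e^2]. *)
Lemma circle_point_near1 (e : R) : 0 < e ->
  exists2 z : C, cabs z = 1 & 0 < cabs (z - 1) <= e.
Proof.
move=> e0; set t := e / 2; have t0 : 0 < t by rewrite /t; lra.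
have d0 : 0 < 1 + t ^+ 2 by nra.
set z : C := (((1 - t ^+ 2) / (1 + t ^+ 2)) +i* (2 * t / (1 + t ^+ 2)))%C.
have dn : 1 + t ^+ 2 != 0 by rewrite lt0r_neq0.
exists z.
  apply/eqP; rewrite -(eqrXn2 (ltn0Sn 1)) ?cabs_ge0 // cabs2E expr1n; apply/eqP.
  by rewrite /z /=; field.
have zE : cabs (z - 1) ^+ 2 = 4 * t ^+ 2 / (1 + t ^+ 2).
  by rewrite cabs2E /z /=; field.
apply/andP; split.
  rewrite lt_def cabs_ge0 andbT; apply/eqP => h.
  move: zE; rewrite h expr0n /= => /esym/eqP; rewrite mulf_eq0 invr_eq0.
  by rewrite (negPf dn) orbF mulf_eq0 expf_eq0 /= (negPf (lt0r_neq0 t0)) pnatr_eq0.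
rewrite -(ler_pXn2r (ltn0Sn 1)) ?nnegrE ?cabs_ge0 ?(ltW e0) // zE ler_pdivrMr //.
have -> : e = 2 * t by rewrite /t; field.
by nra.
Qed.

Lemma expR_le_1B (x : R) : 0 <= x <= 1 / 2 -> expR (- (2 * x)) <= 1 - x.
Proof.
move=> /andP[x0 x1]; rewrite expRN; have := expR_ge1Dx (2 * x).
have x2 : 0 < 1 + 2 * x by lra.
move=> h; apply: (@le_trans _ _ (1 + 2 * x)^-1).
  by rewrite lef_pV2 // posrE expR_gt0.
by rewrite -div1r ler_pdivrMr //; nra.
Qed.

End SliceCoefficients.

(** * Lower bounds near the boundary point *)

Section LowerBound.
Set Implicit Arguments.
Unset Strict Implicit.

Variable R : realType.
Local Notation C := R[i].
Variables p0 p1 q0 q1 : {poly C}.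
Local Notation res_poly := (res_poly p0 p1 q0 q1).
Local Notation wronsk := (wronsk p0 p1).
Local Notation psi := (psi p0 p1).
Local Notation dslice := (dslice p0 p1 q0 q1).

(* e is the distance from a boundary point z to 1; the point w lies at depth
   d ~ e^N below z, where 1 - |psi| is still of order e^N. *)
Lemma near_boundary_points : p0.[1] != 0 -> res_poly != 0 -> res_poly.[1] = 0 ->
  (forall z, cabs z = 1 -> cabs p0.[z] ^+ 2 - cabs p1.[z] ^+ 2 <= cabs res_poly.[z]) ->
  exists A : R, exists2 c : R, 0 < A /\ 0 < c &
  forall e0 : R, 0 < e0 -> exists w, exists2 d : R,
    [/\ 0 < d <= e0, cabs w < 1, d <= 1 - cabs w ^+ 2 & cabs (w - 1) <= e0] &
    c * d <= cabs res_poly.[w] /\ 1 - A * d <= cabs (psi w).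
Proof.
move=> p01 r0 r1 circ.
have [N [u u1 rE]] := multiplicity_XsubC res_poly 1; rewrite r0 /= in u1.
have N0 : (0 < N)%N.
  case: N rE => // rE; move: u1 r1; rewrite rE expr0 mulr1 /root => /negP h h1.
  by case: h; rewrite h1.
have c1 : cabs (1 : C) <= 1 by rewrite cabs1.
have [c0 [e1 [c0p /andP[e1p _]] b0]] := poly_nonzero_near c1 p01.
have [cu [e2 [cup /andP[e2p _]] bu]] := poly_nonzero_near c1 u1.
have [Bu Bup hu] := poly_bounded u.
have [L0 L0p l0] := poly_lipschitz p0; have [L1 L1p l1] := poly_lipschitz p1.
(* [2 Bu d] bounds the resultant at [z]; the first [c0] turns this into a bound on [|p0| - |p1|],
   [L0 + L1] moves it to [w], and the last [c0] divides by [|p0(w)|]. The factor [2 / 2^N] comes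
   from [(e / 2)^N = 2 d / 2^N]. *)
exists ((2 * Bu / c0 + L0 + L1) / c0), (2 * cu / 2 ^+ N).
  split; first by rewrite divr_gt0 // !addr_gt0 // divr_gt0 // mulr_gt0.
  by rewrite divr_gt0 ?mulr_gt0 ?exprn_gt0.
move=> e0 e0p.
have [z z1] : exists2 z : C, cabs z = 1 &
    0 < cabs (z - 1) <= Num.min (1 / 2) (Num.min (e0 / 2) (Num.min (e1 / 2) (e2 / 2))).
  by apply: circle_point_near1; rewrite !lt_min; apply/and4P; split; lra.
set e := cabs (z - 1); rewrite !le_min => /andP[ep /and4P[eh e0h e1h e2h]].
set d : R := e ^+ N / 2.
have dp : 0 < d by rewrite divr_gt0 ?exprn_gt0.
have de : d <= e / 2.
  rewrite ler_pM2r ?invr_gt0 // -[X in _ <= X]expr1; apply: ler_wiXn2l => //; lra.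
set w : C := ((1 - d)%:C)%C * z.
have aw : cabs w = 1 - d by rewrite cabsM z1 mulr1 cabs_real ger0_norm; lra.
have wz : cabs (w - z) = d.
  have -> : w - z = ((- d)%:C)%C * z by rewrite /w !rmorphB !rmorphN rmorph1; ring.
  by rewrite cabsM z1 mulr1 cabs_real normrN gtr0_norm.
have w_up : cabs (w - 1) <= e + d.
  have -> : w - 1 = (w - z) + (z - 1) by ring.
  by apply: le_trans (cabsD _ _) _; rewrite wz -/e; lra.
have w_lo : e / 2 <= cabs (w - 1).
  have := cabsB_ge (z - 1) (z - w).
  have -> : z - 1 - (z - w) = w - 1 by ring.
  by rewrite [cabs (z - w)]cabsB wz -/e; lra.
have w2 : cabs w <= 2 by rewrite aw; lra.
have z2 : cabs z <= 2 by rewrite z1; lra.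
exists w, d; first by split; rewrite ?dp ?aw //=; nra.
split.
  rewrite rE hornerM horner_exp hornerXsubC cabsM cabsX.
  have -> : 2 * cu / 2 ^+ N * d = cu * (e / 2) ^+ N.
    by rewrite /d expr_div_n; field; rewrite expf_neq0 // pnatr_eq0.
  apply: ler_pM; rewrite ?exprn_ge0 ?(ltW cup) //; [lra| |].
    by apply: bu; lra.
  by apply: lerXn2r; rewrite ?nnegrE ?cabs_ge0 //; lra.
have pz : c0 <= cabs p0.[z] by apply: b0; rewrite -/e; lra.
have pw : c0 <= cabs p0.[w] by apply: b0; lra.
have rz : cabs res_poly.[z] <= 2 * Bu * d.
  rewrite rE hornerM horner_exp hornerXsubC cabsM cabsX -/e.
  have -> : 2 * Bu * d = Bu * e ^+ N by rewrite /d; field.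
  by rewrite ler_wpM2r ?exprn_ge0 ?hu // ltW.
(* The difference of squares is divided by [|p0| + |p1| >= c0]; if [|p0| <= |p1|] the left side is
   already nonpositive. *)
have gapz : cabs p0.[z] - cabs p1.[z] <= 2 * Bu / c0 * d.
  have -> : 2 * Bu / c0 * d = 2 * Bu * d / c0 by rewrite mulrAC.
  rewrite ler_pdivlMr //; have := circ z z1; have := cabs_ge0 p1.[z].
  have : 0 <= 2 * Bu * d by apply: mulr_ge0 (ltW dp); rewrite mulr_ge0 // ltW.
  set x := cabs p0.[z] in pz *; set y := cabs p1.[z]; set X := 2 * Bu * d in rz *.
  move=> X0 y0 h; have [xy|yx] := leP x y.
    by apply: le_trans X0; rewrite mulr_le0_ge0 // ?(ltW c0p) // subr_le0.
  have h2 : (x - y) * (x + y) <= X by rewrite -subr_sqr; lra.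
  by apply: le_trans h2; apply: ler_wpM2l; lra.
have gapw : cabs p0.[w] - cabs p1.[w] <= (2 * Bu / c0 + L0 + L1) * d.
  have := l0 _ _ w2 z2; have := l1 _ _ w2 z2; rewrite wz.
  have := cabsB_ge p0.[w] p0.[z]; have := cabsB_ge p1.[z] p1.[w].
  by rewrite [cabs (p1.[z] - _)]cabsB !mulrDl; lra.
have pwp : 0 < cabs p0.[w] by lra.
rewrite /psi cabs_div cabsN lerBlDr -lerBlDl.
have -> : 1 - cabs p1.[w] / cabs p0.[w] = (cabs p0.[w] - cabs p1.[w]) / cabs p0.[w].
  by rewrite mulrBl divff // lt0r_neq0.
rewrite ler_pdivrMr //; apply: le_trans gapw _.
set X := _ + L0 + L1; have Xp : 0 < X by rewrite /X !addr_gt0 // divr_gt0 // mulr_gt0.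
have -> : X / c0 * d * cabs p0.[w] = X * d * (cabs p0.[w] / c0) by ring.
by rewrite ler_peMr ?ler_pdivlMr ?mul1r // ltW // mulr_gt0.
Qed.

(** In [psi^k (psi h' + (k + 1) psi' h)] with [h = res_poly / p0^2], the first summand is bounded by
    [D] while [|psi' h| >= c2 d]. So [K d >= B] makes the bracket at least 1 in modulus, and
    [K d <= B + 1] keeps [|psi|^k] above [E]. *)
Lemma dslice_lower_bound : p0.[1] != 0 -> wronsk.[1] != 0 ->
  res_poly != 0 -> res_poly.[1] = 0 ->
  (forall z, cabs z < 1 -> cabs p1.[z] <= cabs p0.[z]) ->
  (forall z, cabs z = 1 -> cabs p0.[z] ^+ 2 - cabs p1.[z] ^+ 2 <= cabs res_poly.[z]) ->
  exists2 c : R, 0 < c & forall N0 : nat, exists w K, exists2 d : R,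
    [/\ cabs w < 1, 0 < d <= 1 - cabs w ^+ 2 & (N0 < K)%N] &
    forall k, (K <= k <= 2 * K)%N -> c <= K%:R * d * cabs (dslice w k.+2).
Proof.
move=> p01 W1 r0 r1 disk circ.
have [A [c [Ap cp] pts]] := near_boundary_points p01 r0 r1 circ.
have c1 : cabs (1 : C) <= 1 by rewrite cabs1.
have [c0 [e1 [c0p /andP[e1p _]] b0]] := poly_nonzero_near c1 p01.
have [cW [e2 [cWp /andP[e2p _]] bW]] := poly_nonzero_near c1 W1.
have [P Pp hP] := poly_bounded p0.
have [Q Qp hQ] := poly_bounded (dnum p0 p1 q0 q1).
set c2 := cW * c / P ^+ 4; have c2p : 0 < c2 by rewrite divr_gt0 ?mulr_gt0 ?exprn_gt0.
set D := Q / c0 ^+ 3; have Dp : 0 < D by rewrite divr_gt0 ?exprn_gt0.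
set B := (D + 1) / c2; have Bp : 0 < B by rewrite divr_gt0 //; lra.
(* For [k <= 2 K] one has [k d <= 2 B + 2], and [(1 - A d)^k >= exp (- 2 A k d)]. *)
set E := expR (- (2 * A * (2 * B + 2))); have Ep : 0 < E by exact: expR_gt0.
exists (B * E); first by rewrite mulr_gt0.
move=> N0.
have N1p : (0 : R) < N0.+1%:R by rewrite ltr0n.
(* The bound 1 gives [K d <= B + 1], [1 / (2 A)] allows [expR_le_1B], [B / (N0 + 1)] forces
   [K > N0], and [e1], [e2] keep [w] where [p0] and [wronsk] are bounded below. *)
have [w [d [/andP[dp]]]] : exists w, exists2 d : R,
    [/\ 0 < d <= Num.min 1 (Num.min (1 / (2 * A))
         (Num.min (B / N0.+1%:R) (Num.min e1 e2))), cabs w < 1,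
        d <= 1 - cabs w ^+ 2 & cabs (w - 1) <= Num.min 1 (Num.min (1 / (2 * A))
         (Num.min (B / N0.+1%:R) (Num.min e1 e2)))] &
    c * d <= cabs res_poly.[w] /\ 1 - A * d <= cabs (psi w).
  apply: pts; rewrite !lt_min; apply/and5P; split=> //; last exact: divr_gt0.
  by apply: divr_gt0 => //; apply: mulr_gt0.
rewrite !le_min => /and5P[d1 dA dB _ _] w1 dw /and5P[_ _ _ we1 we2] [hr hpsi].
set K := (Num.truncn (B / d)).+1.
have Bd0 : 0 <= B / d by rewrite ltW // divr_gt0.
have [K1 K2] : B <= K%:R * d /\ K%:R * d <= B + d.
  have /andP[h1 h2] := truncn_itv Bd0.
  split; first by rewrite -ler_pdivrMr // ltW.
  by rewrite /K -natr1 mulrDl mul1r lerD2r -ler_pdivlMr.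
exists w, K, d.
  split=> //; first by rewrite dp.
  rewrite -(ler_nat R) -(ler_pM2r dp); apply: le_trans K1.
  by rewrite mulrC -ler_pdivlMr.
move=> k /andP[Kk kK].
have [{}Kk {}kK] : K%:R <= k%:R :> R /\ k%:R <= 2 * K%:R :> R.
  by rewrite -natrM !ler_nat.
have w2 : cabs w <= 2 by lra.
have pw := b0 w we1; have pw2 := hP w w2; have pwp : 0 < cabs p0.[w] by lra.
have psi1 : cabs (psi w) <= 1.
  by rewrite /psi cabs_div cabsN ler_pdivrMr // mul1r disk.
have psik : E <= cabs (psi w) ^+ k.
  have x12 : 0 <= A * d <= 1 / 2.
    rewrite mulr_ge0 ?(ltW Ap) ?(ltW dp) //=.
    by move: dA; rewrite ler_pdivlMr ?mulr_gt0 //; lra.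
  have h := expR_le_1B x12.
  apply: (@le_trans _ _ (expR (- (2 * (A * d))) ^+ k)); last first.
    by apply: lerXn2r; rewrite ?nnegrE ?expR_ge0 ?cabs_ge0 // (le_trans h).
  rewrite -expRM_natl ler_expR mulrN lerN2.
  have -> : k%:R * (2 * (A * d)) = 2 * A * (k%:R * d) by ring.
  by rewrite ler_pM2l ?mulr_gt0 //; nra.
set G := wronsk.[w] / p0.[w] ^+ 2 * (res_poly.[w] / p0.[w] ^+ 2).
have Gge : c2 * d <= cabs G.
  have -> : cabs G = cabs wronsk.[w] * cabs res_poly.[w] / cabs p0.[w] ^+ 4.
    by rewrite /G cabsM !cabs_div !cabsX; field; rewrite lt0r_neq0.
  have -> : c2 * d = cW * (c * d) / P ^+ 4 by rewrite /c2; ring.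
  apply: ler_pM.
  - by rewrite mulr_ge0 ?mulr_ge0 // ltW.
  - by rewrite invr_ge0 exprn_ge0 // ltW.
  - by apply: ler_pM; rewrite ?mulr_ge0 ?(ltW cWp) ?(ltW cp) ?(ltW dp) ?bW.
  - rewrite lef_pV2 ?posrE ?exprn_gt0 //.
    by apply: lerXn2r; rewrite ?nnegrE ?(ltW Pp) ?cabs_ge0.
set D1 := (dnum p0 p1 q0 q1).[w] / p0.[w] ^+ 3.
have D1le : cabs D1 <= D.
  rewrite /D1 cabs_div cabsX /D; apply: ler_pM; rewrite ?cabs_ge0 ?invr_ge0 ?exprn_ge0 ?cabs_ge0 ?hQ //.
  rewrite lef_pV2 ?posrE ?exprn_gt0 //.
  by apply: lerXn2r; rewrite ?nnegrE ?(ltW c0p) ?cabs_ge0.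
have T1 : 1 <= cabs (psi w * D1 + k.+1%:R * G).
  have := cabsB_ge (k.+1%:R * G) (- (psi w * D1)).
  rewrite cabsN opprK [k.+1%:R * G + _]addrC (cabsM _ G) (cabsM _ D1) cabs_nat.
  have : cabs (psi w) * cabs D1 <= D.
    by apply: le_trans D1le; rewrite ler_piMl ?cabs_ge0.
  have : D + 1 <= k.+1%:R * cabs G; last by lra.
  have -> : D + 1 = B * c2 by rewrite /B divfK // lt0r_neq0.
  apply: (@le_trans _ _ (K%:R * d * c2)); first by rewrite ler_pM2r.
  have -> : K%:R * d * c2 = K%:R * (c2 * d) by ring.
  apply: ler_pM => //; first by rewrite mulr_ge0 // ltW.
  by apply: le_trans Kk _; rewrite ler_nat.
rewrite /dslice -/D1 -/G cabsM cabsX.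
apply: ler_pM => //; [exact: ltW|exact: ltW|].
by rewrite -[E]mulr1; apply: ler_pM => //; exact: ltW.
Qed.
End LowerBound.

(** * Divergence of the Dirichlet norm *)

Section Divergence.
Set Implicit Arguments.
Unset Strict Implicit.

Variable R : realType.
Local Notation C := R[i].
Variable a : nat -> nat -> C.

Definition drow N k : R := \sum_(l < N) (k.+1 * l.+1)%:R * cabs (a k l) ^+ 2.
Definition dsum N : R := \sum_(0 <= k < N) drow N k.

Lemma drow_ge0 N k : 0 <= drow N k.
Proof. by apply: sumr_ge0 => l _; rewrite mulr_ge0 // sqr_ge0. Qed.

Lemma drowE N k :
  drow N k = k.+1%:R * \sum_(l < N) l.+1%:R * cabs (a k l) ^+ 2.
Proof. by rewrite mulr_sumr; apply: eq_bigr => l _; rewrite natrM mulrA. Qed.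

Lemma le_drow N M k : (N <= M)%N -> drow N k <= drow M k.
Proof.
move=> NM; rewrite /drow -2!(big_mkord xpredT (fun l => (k.+1 * l.+1)%:R * cabs (a k l) ^+ 2)).
rewrite (big_cat_nat (leq0n N) NM) /= lerDl.
by apply: sumr_ge0 => l _; rewrite mulr_ge0 // sqr_ge0.
Qed.

(** The square of side [N0] and the rows from [i] to [j - 1] are disjoint parts of the square of
    side [N], and all terms are nonnegative. *)
Lemma dsum_block N0 N i j : (N0 <= i <= j)%N -> (j <= N)%N ->
  dsum N0 + \sum_(i <= k < j) drow N k <= dsum N.
Proof.
move=> /andP[N0i ij] jN; have iN := leq_trans ij jN.
rewrite /dsum (big_cat_nat (leq0n N0) (leq_trans N0i iN)) /=.
apply: lerD.
  by apply: ler_sum => k _; apply: le_drow; exact: leq_trans iN.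
rewrite (big_cat_nat N0i iN) (big_cat_nat ij jN) /=.
have s0 m1 m2 : 0 <= \sum_(m1 <= k < m2) drow N k.
  by apply: sumr_ge0 => k _; exact: drow_ge0.
by have := s0 N0 i; have := s0 j N; lra.
Qed.

Lemma in_dirichletE : in_dirichlet a <-> exists M, forall N, dsum N <= M.
Proof.
suff E N : \sum_(k < N) \sum_(l < N) (k.+1 * l.+1)%:R * `|a k l| ^+ 2 =
    ((dsum N)%:C)%C.
  by split=> -[M h]; exists M => N; have := h N; rewrite E lecR.
rewrite /dsum big_mkord rmorph_sum; apply: eq_bigr => k _.
rewrite rmorph_sum; apply: eq_bigr => l _.
by rewrite rmorphM rmorph_nat rmorphXn /= -cabsE.
Qed.

(** All weights are at least 1. The assumed finiteness of the norm thus supplies the uniform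
    coefficient bound that the limits inside the disk require. *)
Lemma dsum_coef_bound M : (forall N, dsum N <= M) ->
  forall k l, cabs (a k l) <= 1 + M.
Proof.
move=> hM k l; set N := (maxn k l).+1.
have kN : (k < N)%N by rewrite ltnS leq_maxl.
have lN : (l < N)%N by rewrite ltnS leq_maxr.
have h1 : drow N k <= M.
  apply: le_trans (hM N); rewrite /dsum big_mkord (bigD1 (Ordinal kN)) //= lerDl.
  by apply: sumr_ge0 => i _; exact: drow_ge0.
have h2 : cabs (a k l) ^+ 2 <= M.
  apply: le_trans h1; rewrite /drow (bigD1 (Ordinal lN)) //= -[X in X <= _]addr0.
  apply: lerD; last by apply: sumr_ge0 => i _; rewrite mulr_ge0 // sqr_ge0.
  by rewrite ler_peMl ?sqr_ge0 // ler1n muln_gt0.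
by have := sqr_ge0 (cabs (a k l) - 1); nra.
Qed.

(** Provides one truncation length valid for a whole block of rows: the maximum of finitely many
    thresholds. *)
Lemma null_uniform (u : nat -> nat -> C) (v : nat -> R) m :
  (forall k, (k < m)%N -> 0 < v k) -> (forall k, null_seq (u k)) ->
  exists L0, forall k L, (k < m)%N -> (L0 <= L)%N -> cabs (u k L) <= v k.
Proof.
elim: m => [|m IH] v0 nu; first by exists 0%N.
have [|L0 h0] := IH _ nu; first by move=> k km; rewrite v0 // ltnW.
have [L1 h1] := nu m _ (v0 m (ltnSn m)).
exists (maxn L0 L1) => k L; rewrite geq_max ltnS leq_eqVlt => /orP[/eqP->|km] /andP[hL0 hL1].
  exact: h1.
exact: h0.
Qed.

(* Each block K + 2 <= k < 2 K + 2 contributes at least c^2 / 4. *)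
Lemma block_unbounded (D : C -> nat -> C) (c : R) : 0 < c ->
  (forall w, cabs w < 1 -> forall k, null_seq (fun L => ((trunc (a k) L)^`()).[w] - D w k)) ->
  (forall N0 : nat, exists w K, exists2 d : R,
    [/\ cabs w < 1, 0 < d <= 1 - cabs w ^+ 2 & (N0 < K)%N] &
    forall k, (K <= k <= 2 * K)%N -> c <= K%:R * d * cabs (D w k.+2)) ->
  ~ exists M, forall N, dsum N <= M.
Proof.
move=> c0 lim low [M hM].
have step N0 : exists N, dsum N0 + c ^+ 2 / 4 <= dsum N.
  have [w [K [d [w1 dw N0K] hK]]] := low N0; have dp : 0 < d by case/andP: dw.
  have K0 : (0 : R) < K%:R by rewrite ltr0n (leq_ltn_trans _ N0K).
  pose u k L := ((trunc (a (K + k).+2) L)^`()).[w] - D w (K + k).+2.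
  (* With half the limit as tolerance, the truncated derivative keeps at least half of its
     modulus. *)
  pose v k := cabs (D w (K + k).+2) / 2.
  have hDk k : (k < K)%N -> c <= K%:R * d * cabs (D w (K + k).+2).
    by move=> kK; apply: hK; rewrite leq_addr mul2n -addnn leq_add2l ltnW.
  have [||L0 hL0] := @null_uniform u v K.
  - move=> k /hDk h; rewrite divr_gt0 // cabs_gt0; apply: contraTneq h => ->.
    by rewrite cabs0 mulr0 -ltNge.
  - by move=> k; exact: lim.
  set N := maxn L0 (K + K).+2; exists N.
  apply: le_trans (@dsum_block N0 N K.+2 (K + K).+2 _ (leq_maxr _ _)); last first.
    by rewrite (leq_trans (ltnW N0K)) //= ?ltnS ?leq_addr // -addn2 leq_addr.
  rewrite lerD2l.
  have -> : \sum_(K.+2 <= k < (K + K).+2) drow N k = \sum_(k < K) drow N (K + k).+2.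
    rewrite -{1}[K.+2]add0n big_addn !subSS addnK big_mkord.
    by apply: eq_bigr => i _; rewrite addnC.
  (* The gain is split evenly over [K] rows. Of the two factors in [c^2 / 4 <= K^2 S], one pays for
     this split and the other is absorbed by the row weight, which exceeds [K]. *)
  have -> : c ^+ 2 / 4 = \sum_(k < K) c ^+ 2 / 4 / K%:R.
    by rewrite sumr_const card_ord -[RHS]mulr_natr divfK // lt0r_neq0.
  apply: ler_sum => k _; set x := cabs (D w (K + k).+2).
  have h := hDk k (ltn_ord k).
  have := hL0 k N (ltn_ord k) (leq_maxl _ _); rewrite /u /v -/x => hu.
  have := trunc_deriv_le (a (K + k).+2) N w1 dw.
  set y := cabs (_.[w]); set S := \sum_(l < N) _ => hS.
  have xy : x / 2 <= y.
    have := cabsB_le ((trunc (a (K + k).+2) N)^`()).[w]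
      (((trunc (a (K + k).+2) N)^`()).[w] - D w (K + k).+2).
    by rewrite opprB addrC subrK -/x -/y; lra.
  rewrite drowE -/S ler_pdivrMr // [X in _ <= X]mulrAC.
  have x0 : 0 <= x by exact: cabs_ge0.
  have h2 : c ^+ 2 <= (K%:R * d * x) ^+ 2.
    by apply: lerXn2r; rewrite ?nnegrE ?(ltW c0) // (le_trans (ltW c0)).
  have h3 : (x / 2) ^+ 2 * d ^+ 2 <= S.
    apply: le_trans hS; apply: ler_wpM2r; first exact: sqr_ge0.
    by apply: lerXn2r; rewrite ?nnegrE ?cabs_ge0 // divr_ge0.
  have h4 : c ^+ 2 / 4 <= K%:R ^+ 2 * S.
    apply: (@le_trans _ _ (K%:R ^+ 2 * ((x / 2) ^+ 2 * d ^+ 2))).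
      have -> : K%:R ^+ 2 * ((x / 2) ^+ 2 * d ^+ 2) = (K%:R * d * x) ^+ 2 / 4 by field.
      by rewrite ler_pM2r // invr_gt0.
    by apply: ler_wpM2l => //; exact: sqr_ge0.
  apply: le_trans h4 _; apply: ler_wpM2r.
    by apply: sumr_ge0 => l _; rewrite mulr_ge0 // sqr_ge0.
  by rewrite expr2 ler_pM2r // ler_nat -addn3 -addnA leq_addr.
have many m : exists N, m%:R * (c ^+ 2 / 4) <= dsum N.
  elim: m => [|m [N hN]].
    by exists 0%N; rewrite mul0r; apply: sumr_ge0 => k _; exact: drow_ge0.
  have [N' hN'] := step N; exists N'; apply: le_trans hN'.
  by rewrite -natr1 mulrDl mul1r lerD2r.
have q0 : 0 < c ^+ 2 / 4 by rewrite divr_gt0 ?exprn_gt0.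
have M0 : 0 <= M by apply: le_trans (hM 0%N); apply: sumr_ge0 => k _; exact: drow_ge0.
have := archi_boundP (divr_ge0 M0 (ltW q0)).
have [N hN] := many (Num.bound (M / (c ^+ 2 / 4))).
by rewrite ltr_pdivrMr // ltNge (le_trans hN).
Qed.
End Divergence.

(** * Polynomials of degree one in z1 *)

Section BidegreeOne.
Set Implicit Arguments.
Unset Strict Implicit.

Variable R : realType.
Local Notation C := R[i].
Implicit Types d f g : {poly C}.

(** [f^:P] keeps the variable of [f] outermost and ['X%:P] is the inner variable, so this is
    [f(z2) + z1 g(z2)]. *)
Definition affine f g : {poly {poly C}} := f^:P + 'X%:P * g^:P.

Lemma bcoef_affine f g k l : bcoef (affine f g) k l =
  if k is j.+1 then if j is 0 then g`_l else 0 else f`_l.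
Proof.
rewrite /bcoef /affine coefD coefCM !coef_map /= coefD coefC coefXM coefC.
by case: k => [|[|k]] //=; rewrite ?addr0 ?add0r.
Qed.

Lemma beval_affine f g x y : beval (affine f g) x y = f.[y] + x * g.[y].
Proof.
rewrite /beval /affine !(hornerD, hornerM, hornerC) !horner_map /=.
by rewrite !(hornerD, hornerM, hornerC, hornerX).
Qed.

Lemma bcoef_inj (p q : {poly {poly C}}) : bcoef p =2 bcoef q -> p = q.
Proof. by move=> h; apply/polyP => l; apply/polyP => k; exact: h. Qed.

Lemma affine_mull d f g : affine (d * f) (d * g) = d^:P * affine f g.
Proof. by rewrite /affine !rmorphM mulrDr mulrCA. Qed.

Lemma deg1_affine (p : {poly {poly C}}) : deg1 p = 1%N ->
  exists f g, [/\ p = affine f g, g != 0 & (size f <= size p)%N /\ (size g <= size p)%N].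
Proof.
move=> d1; pose f k := \poly_(l < size p) bcoef p k l.
have fE k l : (f k)`_l = bcoef p k l.
  by rewrite coef_poly; case: ltnP => // h; rewrite /bcoef [p`_l]nth_default ?coef0.
have sz l : (size (p`_l)%R <= 2)%N.
  have [lp|lp] := ltnP l (size p); last by rewrite nth_default // size_poly0.
  suff : ((size (p`_l)%R).-1 <= 1)%N by case: (size _) => // -[|[]].
  by rewrite -d1; apply: (leq_bigmax (Ordinal lp)).
have pE : p = affine (f 0) (f 1).
  apply: bcoef_inj => k l; rewrite bcoef_affine !fE; case: k => [|[|k]] //.
  by rewrite /bcoef nth_default // (leq_trans (sz l)).
exists (f 0), (f 1); split=> //; last by rewrite !size_poly.
apply/eqP => g0; have : (deg1 p <= 0)%N; last by rewrite d1.
have b0 k l : (0 < k)%N -> bcoef p k l = 0.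
  by rewrite pE bcoef_affine g0; case: k => [|[|k]] // _; rewrite coef0.
apply/bigmax_leqP => l _; rewrite leqn0 -subn1 subn_eq0.
by apply/leq_sizeP => k; exact: b0.
Qed.

(** The one-variable reflection [z^n conj (f (1 / conj z))] when [f] has degree at most [n]. *)
Definition conj_refl n f : {poly C} := \poly_(l < n.+1) (f`_(n - l))^*.

Lemma refl_affine n f g :
  refl 1 n (affine f g) = affine (conj_refl n g) (conj_refl n f).
Proof.
apply: bcoef_inj => k l; rewrite bcoef_affine /bcoef coef_poly.
rewrite !coef_poly; case: ltnP => h; last by case: k => [|[|k]]; rewrite coef0.
rewrite coef_poly; case: k => [|[|k]] //=; by rewrite bcoef_affine.
Qed.

Lemma conj_refl_circle n f z : (size f <= n.+1)%N -> cabs z = 1 ->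
  (conj_refl n f).[z] = z ^+ n * (f.[z])^*.
Proof.
move=> sz z1; rewrite horner_poly (horner_coef_wide _ sz) rmorph_sum mulr_sumr.
rewrite (reindex_inj rev_ord_inj); apply: eq_bigr => i _ /=.
rewrite subSS subKn -1?ltnS // rmorphM rmorphXn mulrCA; congr (_ * _).
have zz : z * z^* = 1 by rewrite -cabs_sqr z1 expr1n.
have -> : z ^+ n = z ^+ (n - i) * z ^+ i by rewrite -exprD subnK // -ltnS.
by rewrite -mulrA -exprMn zz expr1n mulr1.
Qed.

(** On the circle each reflection is [z^n] times a conjugate, so the resultant equals
    [z^n (|f|^2 - |g|^2)]. *)
Lemma circle_gap n f g z : (size f <= n.+1)%N -> (size g <= n.+1)%N -> cabs z = 1 ->
  cabs f.[z] ^+ 2 - cabs g.[z] ^+ 2 <=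
    cabs (res_poly f g (conj_refl n g) (conj_refl n f)).[z].
Proof.
move=> sf sg z1.
have -> : (res_poly f g (conj_refl n g) (conj_refl n f)).[z] =
    z ^+ n * ((cabs f.[z] ^+ 2 - cabs g.[z] ^+ 2)%:C)%C.
  rewrite /res_poly hornerD hornerN !hornerM !conj_refl_circle // rmorphB /= !cabs_sqr.
  by ring.
by rewrite cabsM cabsX z1 expr1n mul1r cabs_real ler_norm.
Qed.

Lemma taylor_affine f g f' g' (a : nat -> nat -> C) :
  taylor_coefs (affine f' g') (affine f g) a ->
  [/\ forall l, \sum_(j < l.+1) f`_j * a 0 (l - j)%N = f'`_l,
      forall l, \sum_(j < l.+1) f`_j * a 1 (l - j)%N +
                \sum_(j < l.+1) g`_j * a 0 (l - j)%N = g'`_l &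
      forall k l, \sum_(j < l.+1) f`_j * a k.+2 (l - j)%N +
                  \sum_(j < l.+1) g`_j * a k.+1 (l - j)%N = 0].
Proof.
move=> H; split=> [l|l|k l].
- have := H 0%N l; rewrite big_ord1 bcoef_affine => <-.
  by apply: eq_bigr => j _; rewrite bcoef_affine subn0.
- have := H 1%N l; rewrite big_ord_recl big_ord1 bcoef_affine => <-.
  by congr (_ + _); apply: eq_bigr => j _; rewrite bcoef_affine.
- have := H k.+2 l; rewrite 2!big_ord_recl bcoef_affine [X in _ + (_ + X)]big1.
    rewrite addr0 => H0; rewrite -[RHS]H0.
    by congr (_ + _); apply: eq_bigr => j _; rewrite bcoef_affine //= ?subn0 ?subSS ?subn0.
  by move=> i _; apply: big1 => j _; rewrite bcoef_affine mul0r.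
Qed.

Lemma is_const_lift d : is_const (d^:P) -> (size d <= 1)%N.
Proof.
move=> [c dc]; have : size (d^:P) = size (bconst c) by rewrite dc.
by rewrite size_map_polyC => ->; exact: size_polyC_leq1.
Qed.

Lemma is_const_affine f g : is_const (affine f g) -> g = 0.
Proof.
move=> [c h]; apply/polyP => l; rewrite coef0.
have -> : g`_l = bcoef (affine f g) 1 l by rewrite bcoef_affine.
by rewrite h /bcoef /bconst coefC; case: eqP; rewrite ?coefC ?coef0.
Qed.

(** The gcd of [f] and [g] factors out of [affine f g]. By irreducibility it is constant, since a
    constant cofactor would give [g = 0]. *)
Lemma irreducible_coprime f g : g != 0 -> birreducible (affine f g) -> coprimep f g.
Proof.
move=> g0 [_ irr]; set d := gcdp f g.
have [u fE] := dvdpP _ _ (dvdp_gcdl f g); have [v gE] := dvdpP _ _ (dvdp_gcdr f g).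
rewrite -/d in fE gE.
have : affine f g = d^:P * affine u v.
  by rewrite -affine_mull {1}fE {1}gE ![_ * d]mulrC.
have d0 : d != 0 by rewrite gcdp_eq0 (negPf g0) andbF.
move=> /irr[/is_const_lift sd|/is_const_affine v0].
  by rewrite /coprimep eqn_leq sd size_poly_gt0.
by move: g0; rewrite gE v0 mul0r eqxx.
Qed.

(** If [g = - f], the polynomial is [f(z2) (1 - z1)]; irreducibility then makes [f] constant,
    against positive degree in [z2]. *)
Lemma irreducible_sum_neq0 f g : (1 < size (affine f g))%N ->
  birreducible (affine f g) -> f + g != 0.
Proof.
move=> sz [_ irr]; apply/eqP => fg; have gE : g = - f by apply/eqP; rewrite -addr_eq0 addrC fg.
have aE : affine f g = f^:P * affine 1 (-1).
  by rewrite -affine_mull mulr1 mulrN1 gE.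
case: (irr _ _ aE) => [/is_const_lift sf|/is_const_affine/eqP]; last first.
  by rewrite oppr_eq0 oner_eq0.
move: sz; rewrite ltnNge => /negP; apply; rewrite /affine gE.
apply: leq_trans (size_polyD _ _) _; rewrite geq_max size_map_polyC sf /=.
rewrite mul_polyC; apply: leq_trans (size_scale_leq _ _) _.
by rewrite size_map_polyC size_polyN.
Qed.

(* If res_poly = 0, Bezout for f and g shows that affine f g divides affine f' g'. *)
Lemma res_neq0 f g f' g' : coprimep f g -> ~ is_const (affine f g) ->
  no_common_factor (affine f g) (affine f' g') -> res_poly f g f' g' != 0.
Proof.
move=> /Bezout_eq1_coprimepP[[u v] /= uv] nc ncf; apply/eqP => /eqP.
rewrite /res_poly subr_eq0 => /eqP r0; apply: nc; apply: ncf.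
  by exists 1; rewrite mulr1.
exists ((u * f' + v * g')^:P).
rewrite -[LHS]mul1r -(rmorph1 (map_poly (@polyC C))) -uv /affine.
rewrite !rmorphD !rmorphM /=.
have r0P : f^:P * g'^:P = g^:P * f'^:P by rewrite -!rmorphM r0.
transitivity (u^:P * (f^:P * f'^:P + 'X%:P * (f^:P * g'^:P)) +
   v^:P * (g^:P * f'^:P + 'X%:P * (g^:P * g'^:P))); first by ring.
by rewrite {1}r0P -{2}r0P; ring.
Qed.

(** If [|g(z)| > |f(z)|], then [z1 = - f(z) / g(z)] would be a zero inside the disk. *)
Lemma no_zeros_affine f g : no_zeros_bidisk (affine f g) ->
  forall z, cabs z < 1 -> f.[z] != 0 /\ cabs g.[z] <= cabs f.[z].
Proof.
move=> nz z z1; have fz : f.[z] != 0.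
  have := nz 0 z; rewrite beval_affine mul0r addr0; apply.
    by apply/in_diskE; rewrite cabs0.
  exact/in_diskE.
split=> //; rewrite leNgt; apply/negP => lt.
have g0 : 0 < cabs g.[z] := le_lt_trans (cabs_ge0 _) lt.
have gz : g.[z] != 0 by rewrite -cabs_gt0.
have := nz (- f.[z] / g.[z]) z; rewrite beval_affine divfK // addrN eqxx.
move=> h; suff : false by [].
apply: h; last exact/in_diskE.
by apply/in_diskE; rewrite cabs_div cabsN ltr_pdivrMr // mul1r.
Qed.

(** The condition [g(1) = - f(1)] reduces the Wronskian at 1 to [- f(1) (f + g)'(1)], and [f + g]
    has a simple zero there. *)
Lemma wronsk_neq0 f g :
  (forall z, cabs z < 1 -> cabs g.[z] <= cabs f.[z]) ->
  f + g != 0 -> f.[1] + g.[1] = 0 -> f.[1] != 0 -> (wronsk f g).[1] != 0.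
Proof.
move=> le fg0 fg1 f1.
have := @boundary_root_simple R f (f + g).
have -> : f + g - f = g by rewrite addrAC subrr add0r.
rewrite hornerD => /(_ le fg0 fg1 f1).
have g1 : g.[1] = - f.[1] by apply/eqP; rewrite -addr_eq0 addrC fg1.
rewrite /wronsk derivD !(hornerD, hornerN, hornerM) g1 => h.
have -> : - f.[1] * (f^`()).[1] - (g^`()).[1] * f.[1] =
  - f.[1] * ((f^`()).[1] + (g^`()).[1]) by ring.
by rewrite mulf_neq0 // oppr_eq0.
Qed.

Lemma NT2_neq0 (p q : {poly {poly C}}) N : NT2 p q N -> (0 < N)%N ->
  exists lam, common_zero_T2 p q lam.
Proof.
move=> [[|lam s] [mu [_ [hs [_ <-]]]]]; first by rewrite big_nil.
by move=> _; exists lam; apply/hs; rewrite mem_head.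
Qed.
End BidegreeOne.

Theorem theorem10p2 (R : realType) (p : {poly {poly R[i]}}) (n : nat) :
  (2 <= n)%N ->
  no_zeros_bidisk p ->
  atoral p ->
  deg1 p = 1%N -> deg2 p = n ->
  (* deg phi = deg p : phi = p~/p is in lowest terms *)
  no_common_factor p (refl 1 n p) ->
  NT2 p (refl 1 n p) (2 * n)%N ->
  birreducible p ->
  (forall a b : R[i], in_circle a -> in_circle b -> beval p a b = 0 ->
     a = 1 /\ b = 1) ->
  forall a : nat -> nat -> R[i],
    taylor_coefs (refl 1 n p) p a -> ~ in_dirichlet a.
Proof.
move=> n2 nz _ d1 d2 ncf NT irr uniq1 a.
have sp : size p = n.+1.
  by move: d2 n2; rewrite /deg2; case: (size p) => [|m] /= <-.
have [p0 [p1 [pE p10 [sz0 sz1]]]] := deg1_affine d1.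
rewrite sp in sz0 sz1; rewrite pE in sp nz ncf NT irr uniq1 *.
rewrite refl_affine in ncf NT *.
set q0 := conj_refl n p1 in ncf NT *; set q1 := conj_refl n p0 in ncf NT *.
move=> ta /in_dirichletE[M hM].
(* The positive intersection count yields a common zero on the torus, which [uniq1] locates at
   [(1, 1)]. *)
have [[x y] [/= x1 [y1 [pxy qxy]]]] : exists lam,
    common_zero_T2 (affine p0 p1) (affine q0 q1) lam.
  by apply: (NT2_neq0 NT); rewrite muln_gt0 /= (leq_trans _ n2).
have [ex ey] := uniq1 _ _ x1 y1 pxy.
rewrite ex ey !beval_affine !mul1r in pxy qxy.
have cop := irreducible_coprime p10 irr.
(* Otherwise [p1(1) = 0] as well, and the Bezout identity at 1 would read [0 = 1]. *)
have p01 : p0.[1] != 0.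
  have [[u v] /= uv] := Bezout_eq1_coprimepP _ _ cop.
  apply/eqP => h; have := congr1 (fun f => f.[1]) uv.
  move: pxy; rewrite h add0r => h1; rewrite !hornerE h h1 !mulr0 addr0.
  by move=> /eqP; rewrite eq_sym oner_eq0.
have disk z : cabs z < 1 -> cabs p1.[z] <= cabs p0.[z].
  by move=> /(no_zeros_affine nz)[].
have fg0 : p0 + p1 != 0 by apply: irreducible_sum_neq0 irr; rewrite sp ltnS ltnW.
have W1 := wronsk_neq0 disk fg0 pxy p01.
have r0 : res_poly p0 p1 q0 q1 != 0 by apply: res_neq0 => //; case: irr.
have r1 : (res_poly p0 p1 q0 q1).[1] = 0.
  have p1E : p1.[1] = - p0.[1] by apply/eqP; rewrite -addr_eq0 addrC pxy.
  rewrite /res_poly hornerD hornerN !hornerM p1E.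
  have -> : p0.[1] * q1.[1] - - p0.[1] * q0.[1] = p0.[1] * (q0.[1] + q1.[1]) by ring.
  by rewrite qxy mulr0.
have [c c0 low] := dslice_lower_bound p01 W1 r0 r1 disk
  (fun z => @circle_gap R n p0 p1 z sz0 sz1).
have [E0 E1 E2] := taylor_affine ta.
apply: (block_unbounded c0 _ low) (ex_intro _ M hM) => w w1 k.
have [pw _] := no_zeros_affine nz w1.
exact: (slice_limits (dsum_coef_bound hM) w1 pw E0 E1 E2).
Qed.
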